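(* Let $\sigma,\rho\in\mathfrak{S}_n$. (1) The set $I(\sigma,\rho):=\{\pi_\gamma\overline{\pi}_\rho \mid \gamma\in[\sigma,w_0\rho^{-1}]_L\}$ forms a $\mathbb{C}$-basis for the left ideal $H_n(0)\pi_\sigma\overline{\pi}_\rho$. (2) For any $\pi_\gamma\overline{\pi}_\rho\in I(\sigma,\rho)$ (with $\gamma\in[\sigma,w_0\rho^{-1}]_L$) and $1\le i\le n-1$, $$\pi_i\cdot(\pi_\gamma\overline{\pi}_\rho)=\begin{cases}\pi_\gamma\overline{\pi}_\rho & \text{if } i\in\mathrm{Des}_L(\gamma),\\ \pi_{s_i\gamma}\overline{\pi}_\rho & \text{if } i\notin\mathrm{Des}_L(\gamma).\end{cases}$$ Moreover, if $i\notin\mathrm{Des}_L(\gamma)$, then $\pi_{s_i\gamma}\overline{\pi}_\rho=0$ if and only if $i\in\mathrm{Des}_L(\gamma\rho)$. (3) The linear map $\mathsf{em}:\mathsf{B}(\sigma,\rho)\to H_n(0)\pi_\sigma\overline{\pi}_{\rho^{-1}w_0}$ defined by $\gamma\mapsto\pi_\gamma\overline{\pi}_{\rho^{-1}w_0}$ for $\gamma\in[\sigma,\rho]_L$ is an $H_n(0)$-module isomorphism.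
   Context: Permutations in the symmetric group $\mathfrak{S}_n$ are composed as functions; $s_i=(i,i+1)$; $\ell$ is the Coxeter length; $w_0$ is the longest element of $\mathfrak{S}_n$; $\mathrm{Des}_L(\sigma)=\{i\in[n-1]\mid \ell(s_i\sigma)<\ell(\sigma)\}$. The left weak Bruhat order: $\sigma\preceq_L\rho$ iff $\rho=\gamma\sigma$ with $\ell(\rho)=\ell(\gamma)+\ell(\sigma)$ for some $\gamma\in\mathfrak{S}_n$; $[\sigma,\rho]_L=\{\gamma\mid\sigma\preceq_L\gamma\preceq_L\rho\}$ (possibly empty). The $0$-Hecke algebra $H_n(0)$ is the associative unital $\mathbb{C}$-algebra generated by $\pi_1,\dots,\pi_{n-1}$ with relations $\pi_i^2=\pi_i$, $\pi_i\pi_{i+1}\pi_i=\pi_{i+1}\pi_i\pi_{i+1}$, and $\pi_i\pi_j=\pi_j\pi_i$ if $|i-j|\ge2$. Put $\overline{\pi}_i:=\pi_i-1$. For a reduced expression $s_{i_1}\cdots s_{i_p}$ of $\sigma$, $\pi_\sigma:=\pi_{i_1}\cdots\pi_{i_p}$ and $\overline{\pi}_\sigma:=\overline{\pi}_{i_1}\cdots\overline{\pi}_{i_p}$ (independent of the reduced expression). The weak Bruhat interval module $\mathsf{B}(\sigma,\rho)$ is the left $H_n(0)$-module with underlying space $\mathbb{C}[\sigma,\rho]_L$ (basis $[\sigma,\rho]_L$) and action: $\pi_i\cdot\gamma=\gamma$ if $i\in\mathrm{Des}_L(\gamma)$; $\pi_i\cdot\gamma=0$ if $i\notin\mathrm{Des}_L(\gamma)$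 and $s_i\gamma\notin[\sigma,\rho]_L$; $\pi_i\cdot\gamma=s_i\gamma$ if $i\notin\mathrm{Des}_L(\gamma)$ and $s_i\gamma\in[\sigma,\rho]_L$. *)

(* Defs.v *)
From HB Require Import structures.
From mathcomp Require Import all_boot all_order all_fingroup all_algebra.
From mathcomp Require Import boolp classical_sets reals.
From mathcomp Require Import complex.
From mathcomp Require Import zify.

Set Implicit Arguments.
Unset Strict Implicit.
Unset Printing Implicit Defensive.


(* MathComp's product of permutations applies its left factor first;
   [pcomp] is the composition of functions. *)
Definition pcomp (n : nat) (s t : 'S_n) : 'S_n := (t * s)%g.
Notation "s \oP t" := (pcomp s t) (at level 40, left associativity).

Section Coxeter.
Variable n : nat.
Implicit Types (s t g x : 'S_n) (i j : 'I_n.-1) (w : seq 'I_n.-1).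

Lemma pcompE s t k : (s \oP t) k = s (t k).
Proof. by rewrite /pcomp permM. Qed.

Lemma pcompA s t g : s \oP (t \oP g) = s \oP t \oP g.
Proof. by rewrite /pcomp mulgA. Qed.

Fact lo_subproof i : i < n. Proof. by case: i => i /=; lia. Qed.
Fact hi_subproof i : i.+1 < n. Proof. by case: i => i /=; lia. Qed.
Definition lo i : 'I_n := Ordinal (lo_subproof i).
Definition hi i : 'I_n := Ordinal (hi_subproof i).

(* Everything is indexed from 0: [adj i] is the transposition of i and i+1
   in {0, ..., n-1}, where 0 <= i < n-1. *)
Definition adj i : 'S_n := tperm (lo i) (hi i).

Definition wprod w : 'S_n := foldr (fun i t => adj i \oP t) 1%g w.

(* [inv], [des] and [dem] are only used in proofs: by [ell_inv] and [DesLE] the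
   first two are the Coxeter length [ell] and membership in [DesL]. *)
Definition inv s : nat :=
  #|[set p : 'I_n * 'I_n | (p.1 < p.2)%N && (s p.2 < s p.1)%N]|.

Definition des x i : bool := (x^-1 (hi i) < x^-1 (lo i))%N%g.

Lemma lo_neq_hi i : (lo i == hi i) = false.
Proof. by apply/eqP => /(congr1 val) /=; lia. Qed.

Lemma adjlt i (a b : 'I_n) : a != b ->
  (adj i a < adj i b)%N =
    if (a == lo i) && (b == hi i) then false
    else if (a == hi i) && (b == lo i) then true else (a < b)%N.
Proof.
have neqE (k l : 'I_n) : k <> l -> k <> l :> nat by move=> kl /val_inj.
rewrite -!val_eqE /adj /=; case: tpermP => [->|->|/neqE /= a1 /neqE /= a2];
  case: tpermP => [->|->|/neqE /= b1 /neqE /= b2] /=.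
all: by repeat case: ifP; lia.
Qed.

Lemma adjK i x : adj i \oP (adj i \oP x) = x.
Proof. by rewrite /pcomp -mulgA tperm2 mulg1. Qed.

Lemma adjVE i x k : ((adj i \oP x)^-1)%g k = (x^-1)%g (adj i k).
Proof. by rewrite /pcomp invMg permM tpermV. Qed.

Lemma des_adj i x : des (adj i \oP x) i = ~~ des x i.
Proof.
rewrite /des !adjVE /adj tpermL tpermR -leqNgt [RHS]leq_eqVlt val_eqE.
by rewrite (inj_eq perm_inj) lo_neq_hi.
Qed.

Lemma inv_adj i x : ~~ des x i -> inv (adj i \oP x) = (inv x).+1.
Proof.
move=> ndes.
have lt0 : (x^-1 (lo i) < x^-1 (hi i))%N%g.
  by move: (des_adj i x); rewrite ndes /des !adjVE /adj tpermL tpermR.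
rewrite /inv.
have -> : [set p : 'I_n * 'I_n |
    (p.1 < p.2)%N && ((adj i \oP x) p.2 < (adj i \oP x) p.1)%N] =
  ((x^-1)%g (lo i), (x^-1)%g (hi i)) |: [set p : 'I_n * 'I_n |
    (p.1 < p.2)%N && (x p.2 < x p.1)%N].
  apply/setP => -[a b]; rewrite !inE /= !pcompE xpair_eqE.
  case: (ltnP a b) => [ab|ba] /=; last first.
    rewrite orbF; apply/esym/negP => /andP[/eqP ea /eqP eb].
    by move: lt0; rewrite -ea -eb; lia.
  have neq : x b != x a.
    by rewrite (inj_eq perm_inj) -val_eqE /=; lia.
  rewrite adjlt //.
  have E k l : (x k == l) = (k == (x^-1)%g l).
    by apply/eqP/eqP => [<-|->]; rewrite ?permK ?permKV.
  rewrite !E.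
  case: (boolP ((b == _) && (a == _))) => [/andP[/eqP eb /eqP ea]|_].
    by move: ab; rewrite eb ea; lia.
  by rewrite andbC; case: ifP => // ->; rewrite ?orbT.
by rewrite cardsU1 inE /= !permKV /= [(i.+1 < i)%N]ltnNge leqW ?andbF.
Qed.

Lemma inv1 : inv 1%g = 0%N.
Proof.
apply/eqP; rewrite cards_eq0; apply/eqP/setP => -[a b].
by rewrite !inE !perm1 /=; lia.
Qed.

Lemma inv_wprod w : (inv (wprod w) <= size w)%N.
Proof.
elim: w => [|i w IH] /=; first by rewrite inv1.
case: (boolP (des (wprod w) i)) => d; last by rewrite inv_adj.
have := inv_adj (i := i) (x := adj i \oP wprod w); rewrite des_adj d adjK.
by move=> /(_ isT) e; move: IH; rewrite e; lia.
Qed.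

Lemma no_des x : (forall i, ~~ des x i) -> x = 1%g.
Proof.
move=> nd; pose f := (x^-1)%g.
have inc (k : nat) (h : (k.+1 < n)%N) (h' : (k < n)%N) :
    (f (Ordinal h') < f (Ordinal h))%N.
  have hk : (k < n.-1)%N by lia.
  have := nd (Ordinal hk); rewrite -des_adj /des !adjVE /adj tpermL tpermR.
  have -> : lo (Ordinal hk) = Ordinal h' by exact: val_inj.
  by have -> : hi (Ordinal hk) = Ordinal h by exact: val_inj.
have up (k : nat) (h : (k < n)%N) : (k <= f (Ordinal h))%N.
  elim: k h => // k IH h; have h' : (k < n)%N by lia.
  by have := IH h'; have := inc k h h'; lia.
have down (m k : nat) (h : (k < n)%N) : (k + m)%N = n.-1 -> (f (Ordinal h) <= k)%N.
  elim: m k h => [|m IH] k h e; first by have := ltn_ord (f (Ordinal h)); lia.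
  have h' : (k.+1 < n)%N by lia.
  by have := IH _ h' ltac:(lia); have := inc k h' h; lia.
apply: invg_inj; rewrite invg1; apply/permP => -[k h]; rewrite perm1.
apply: val_inj => /=; apply/eqP; rewrite eqn_leq up andbT.
by apply: (down (n.-1 - k)%N); lia.
Qed.

Lemma inv_word x : exists2 w, wprod w = x & size w = inv x.
Proof.
have [m] := ubnP (inv x); elim: m x => // m IH x lem.
case: (pickP (des x)) => [i d|nd]; last first.
  by exists [::]; rewrite (no_des (fun i => negbT (nd i))) ?inv1.
have e : inv x = (inv (adj i \oP x)).+1.
  by have := @inv_adj i (adj i \oP x); rewrite des_adj d adjK => /(_ isT) ->.
have [|w e1 e2] := IH (adj i \oP x); first by lia.
by exists (i :: w); rewrite /= ?e1 ?adjK // e2 e.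
Qed.

Fact ell_subproof x : exists k, [exists w : k.-tuple 'I_n.-1, wprod w == x].
Proof.
have [w <- _] := inv_word x; exists (size w).
by apply/existsP; exists (in_tuple w).
Qed.

Definition ell x : nat := ex_minn (ell_subproof x).

Definition DesL x : {set 'I_n.-1} := [set i | (ell (adj i \oP x) < ell x)%N].

Definition leL x g : bool :=
  [exists t, (g == t \oP x) && (ell g == ell t + ell x)%N].

Definition intervalL x g : {set 'S_n} := [set t | leL x t && leL t g].

Definition w0 : 'S_n := [arg max_(s > 1%g) ell s].

Lemma ell_inv x : ell x = inv x.
Proof.
rewrite /ell; case: ex_minnP => k /existsP[w ew] kmin.
apply/eqP; rewrite eqn_leq; apply/andP; split; last first.
  by have := inv_wprod w; rewrite (eqP ew) size_tuple.
have [u eu <-] := inv_word x; apply: kmin.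
by apply/existsP; exists (in_tuple u); apply/eqP.
Qed.

Lemma DesLE x i : (i \in DesL x) = des x i.
Proof.
rewrite inE !ell_inv; case: (boolP (des x i)) => d.
  by have := @inv_adj i (adj i \oP x); rewrite des_adj d adjK => /(_ isT) ->; rewrite ltnSn.
by rewrite inv_adj //; lia.
Qed.

Fact redword_subproof x : exists w, (wprod w == x) && (size w == ell x).
Proof. by have [w e1 e2] := inv_word x; exists w; rewrite ell_inv e1 e2 !eqxx. Qed.

(* A chosen reduced expression; by Matsumoto's theorem the products [piw] and
   [pibw] below do not depend on the choice. *)
Definition redword x : seq 'I_n.-1 := xchoose (redword_subproof x).

Lemma redwordP x : wprod (redword x) = x /\ size (redword x) = ell x.
Proof. by have /andP[/eqP ? /eqP] := xchooseP (redword_subproof x). Qed.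

Lemma wprod_cat w1 w2 : wprod (w1 ++ w2) = wprod w1 \oP wprod w2.
Proof.
elim: w1 => [|i w1 /= ->]; last by rewrite pcompA.
by rewrite /pcomp mulg1.
Qed.

Lemma ell_comp x g : (ell (x \oP g) <= ell x + ell g)%N.
Proof.
have [ex <-] := redwordP x; have [eg <-] := redwordP g.
by rewrite -[in leqLHS]ex -[in leqLHS]eg -wprod_cat -size_cat ell_inv inv_wprod.
Qed.

Lemma leL_trans x g t : leL x g -> leL g t -> leL x t.
Proof.
move=> /existsP[u /andP[/eqP -> /eqP eu]] /existsP[v /andP[/eqP -> /eqP ev]].
apply/existsP; exists (v \oP u); rewrite pcompA eqxx /=.
move: (ell_comp v u) (ell_comp (v \oP u) x) ev; rewrite pcompA eu.
by move=> *; apply/eqP; lia.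
Qed.

Lemma ell_adj i : ell (adj i) = 1%N.
Proof.
have -> : adj i = adj i \oP 1%g by rewrite /pcomp mul1g.
by rewrite ell_inv inv_adj ?inv1 // /des invg1 !perm1 /=; lia.
Qed.

Lemma leL_adj i x : ~~ des x i -> leL x (adj i \oP x).
Proof.
by move=> d; apply/existsP; exists (adj i); rewrite eqxx ell_adj !ell_inv inv_adj // add1n eqxx.
Qed.

Definition dem i x : 'S_n := if des x i then x else adj i \oP x.

Lemma dem_idem i x : dem i (dem i x) = dem i x.
Proof.
by rewrite /dem; case: (boolP (des x i)) => d; rewrite ?d // des_adj d.
Qed.

Lemma des_far i j x : (i.+1 < j)%N || (j.+1 < i)%N ->
  des (adj j \oP x) i = des x i.
Proof.
move=> far; rewrite /des !adjVE /adj !tpermD // -val_eqE /=; lia.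
Qed.

Lemma dem_comm i j x : (i.+1 < j)%N || (j.+1 < i)%N ->
  dem i (dem j x) = dem j (dem i x).
Proof.
move=> far; have far' : (j.+1 < i)%N || (i.+1 < j)%N by rewrite orbC.
have c : adj i \oP (adj j \oP x) = adj j \oP (adj i \oP x).
  rewrite !pcompA; congr (_ \oP x); rewrite /pcomp [RHS]conjgC tpermJ.
  by rewrite !tpermD // -val_eqE /=; lia.
rewrite /dem; case: (boolP (des x i)) => di; case: (boolP (des x j)) => dj;
  by rewrite ?des_far // ?(negbTE di) ?(negbTE dj) ?di ?dj ?c.
Qed.

Lemma dem_braid i j x : j = i.+1 :> nat ->
  dem i (dem j (dem i x)) = dem j (dem i (dem j x)).
Proof.
move=> e.
have elo : lo j = hi i by apply: val_inj.
have n1 : (lo i == hi j) = false by rewrite -val_eqE /=; lia.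
have n2 : (hi i == hi j) = false by rewrite -val_eqE /=; lia.
have n3 := lo_neq_hi i.
have c : adj i \oP (adj j \oP (adj i \oP x)) = adj j \oP (adj i \oP (adj j \oP x)).
  rewrite !pcompA; congr (_ \oP x); rewrite /pcomp /adj elo !mulgA.
  rewrite -[X in (X * _ * _)%g]tpermV -mulgA -conjgE tpermJ tpermR.
  rewrite -[X in _ = (X * _ * _)%g]tpermV -[RHS]mulgA -conjgE tpermJ tpermL.
  by rewrite !tpermD ?n1 ?n2 // eq_sym ?n1 ?n3.
have ai : (adj i (lo i) = hi i) * (adj i (hi i) = lo i) * (adj i (hi j) = hi j).
  by rewrite /adj tpermL tpermR tpermD ?n1 ?n2; do !split.
have aj : (adj j (lo i) = lo i) * (adj j (hi i) = hi j) * (adj j (hi j) = hi i).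
  by rewrite /adj elo tpermL tpermR tpermD // 1?eq_sym ?n1 ?n3; do !split.
have inj k l : (k == l) = false -> val ((x^-1)%g k) != val ((x^-1)%g l).
  by rewrite val_eqE (inj_eq perm_inj) => ->.
move: (inj _ _ n1) (inj _ _ n2) (inj _ _ n3) => /= d1 d2 d3.
rewrite /dem; do ![case: ifP]; rewrite /des ?adjVE elo ?(ai, aj) ?c // => *; lia.
Qed.

End Coxeter.

Import GRing.Theory.
Local Open Scope ring_scope.

Section HeckeTerms.
Variables (K : comNzRingType) (n : nat).

Inductive hterm : Type :=
| HZero | HOne | HGen of 'I_n.-1
| HAdd of hterm & hterm | HMul of hterm & hterm | HScale of K & hterm.

(* The least congruence satisfying the axioms of associative unital
   K-algebras and the defining relations of the 0-Hecke algebra. *)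
Inductive heq : hterm -> hterm -> Prop :=
| heq_refl t : heq t t
| heq_sym t u : heq t u -> heq u t
| heq_trans t u v : heq t u -> heq u v -> heq t v
| heq_add t t' u u' : heq t t' -> heq u u' -> heq (HAdd t u) (HAdd t' u')
| heq_mul t t' u u' : heq t t' -> heq u u' -> heq (HMul t u) (HMul t' u')
| heq_scale a t t' : heq t t' -> heq (HScale a t) (HScale a t')
| heq_addA t u v : heq (HAdd t (HAdd u v)) (HAdd (HAdd t u) v)
| heq_addC t u : heq (HAdd t u) (HAdd u t)
| heq_add0 t : heq (HAdd HZero t) t
| heq_addN t : heq (HAdd (HScale (-1) t) t) HZero
| heq_mulA t u v : heq (HMul t (HMul u v)) (HMul (HMul t u) v)
| heq_mul1l t : heq (HMul HOne t) t
| heq_mul1r t : heq (HMul t HOne) t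
| heq_mulDl t u v : heq (HMul (HAdd t u) v) (HAdd (HMul t v) (HMul u v))
| heq_mulDr t u v : heq (HMul t (HAdd u v)) (HAdd (HMul t u) (HMul t v))
| heq_scaleA a b t : heq (HScale a (HScale b t)) (HScale (a * b) t)
| heq_scale1 t : heq (HScale 1 t) t
| heq_scaleDr a t u : heq (HScale a (HAdd t u)) (HAdd (HScale a t) (HScale a u))
| heq_scaleDl a b t : heq (HScale (a + b) t) (HAdd (HScale a t) (HScale b t))
| heq_scaleAl a t u : heq (HScale a (HMul t u)) (HMul (HScale a t) u)
| heq_scaleAr a t u : heq (HScale a (HMul t u)) (HMul t (HScale a u))
| heq_quad i : heq (HMul (HGen i) (HGen i)) (HGen i)
| heq_braid (i j : 'I_n.-1) : j = i.+1 :> nat ->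
    heq (HMul (HMul (HGen i) (HGen j)) (HGen i))
        (HMul (HMul (HGen j) (HGen i)) (HGen j))
| heq_comm (i j : 'I_n.-1) : (i.+1 < j)%N || (j.+1 < i)%N ->
    heq (HMul (HGen i) (HGen j)) (HMul (HGen j) (HGen i)).

HB.instance Definition _ := gen_eqMixin hterm.
HB.instance Definition _ := gen_choiceMixin hterm.

Definition heqb (t u : hterm) : bool := `[< heq t u >].

Lemma heqb_refl : reflexive heqb.
Proof. by move=> t; apply/asboolP/heq_refl. Qed.
Lemma heqb_sym : symmetric heqb.
Proof. by move=> t u; apply/asboolP/asboolP => /heq_sym. Qed.
Lemma heqb_trans : transitive heqb.
Proof.
by move=> u t v /asboolP tu /asboolP uv; apply/asboolP/(heq_trans tu uv).
Qed.
Canonical heq_equiv := EquivRel heqb heqb_refl heqb_sym heqb_trans.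

Definition hecke0 := {eq_quot heq_equiv}%qT.
HB.instance Definition _ := Choice.on hecke0.
HB.instance Definition _ := Quotient.on hecke0.

Local Notation cl := (\pi_hecke0%qT).
Local Notation rep h := (generic_quotient.repr (h : hecke0)).

Lemma heqP t u : cl t = cl u <-> heq t u.
Proof. by split=> [/eqmodP/asboolP|tu] //; apply/eqmodP/asboolP. Qed.

Lemma rep_cl t : heq (rep (cl t)) t.
Proof. by apply/heqP; rewrite reprK. Qed.

Definition h0 : hecke0 := cl HZero.
Definition h1 : hecke0 := cl HOne.
Definition hadd (x y : hecke0) : hecke0 := cl (HAdd (rep x) (rep y)).
Definition hopp (x : hecke0) : hecke0 := cl (HScale (-1) (rep x)).
Definition hmul (x y : hecke0) : hecke0 := cl (HMul (rep x) (rep y)).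
Definition hscale a (x : hecke0) : hecke0 := cl (HScale a (rep x)).

Lemma hadd_cl t u : hadd (cl t) (cl u) = cl (HAdd t u).
Proof. by apply/heqP; apply: heq_add; exact: rep_cl. Qed.
Lemma hmul_cl t u : hmul (cl t) (cl u) = cl (HMul t u).
Proof. by apply/heqP; apply: heq_mul; exact: rep_cl. Qed.
Lemma hopp_cl t : hopp (cl t) = cl (HScale (-1) t).
Proof. by apply/heqP; apply: heq_scale; exact: rep_cl. Qed.
Lemma hscale_cl a t : hscale a (cl t) = cl (HScale a t).
Proof. by apply/heqP; apply: heq_scale; exact: rep_cl. Qed.

Let hE := (hadd_cl, hmul_cl, hopp_cl, hscale_cl).
Let cl_ind (P : hecke0 -> Prop) : (forall t, P (cl t)) -> forall x, P x.
Proof. by move=> Pcl x; rewrite -[x]reprK; apply: Pcl. Qed.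

Lemma haddA : associative hadd.
Proof.
do 3!elim/cl_ind=> ?; rewrite !hE; apply/heqP; exact: heq_addA.
Qed.
Lemma haddC : commutative hadd.
Proof. do 2!elim/cl_ind=> ?; rewrite !hE; apply/heqP; exact: heq_addC. Qed.
Lemma hadd0 : left_id h0 hadd.
Proof. by elim/cl_ind=> ?; rewrite !hE; apply/heqP; exact: heq_add0. Qed.
Lemma haddN : left_inverse h0 hopp hadd.
Proof. by elim/cl_ind=> ?; rewrite !hE; apply/heqP; exact: heq_addN. Qed.
HB.instance Definition _ := GRing.isZmodule.Build hecke0 haddA haddC hadd0 haddN.

Lemma hmulA : associative hmul.
Proof. do 3!elim/cl_ind=> ?; rewrite !hE; apply/heqP; exact: heq_mulA. Qed.
Lemma hmul1l : left_id h1 hmul.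
Proof. by elim/cl_ind=> ?; rewrite !hE; apply/heqP; exact: heq_mul1l. Qed.
Lemma hmul1r : right_id h1 hmul.
Proof. by elim/cl_ind=> ?; rewrite !hE; apply/heqP; exact: heq_mul1r. Qed.
Lemma hmulDl : left_distributive hmul hadd.
Proof. do 3!elim/cl_ind=> ?; rewrite !hE; apply/heqP; exact: heq_mulDl. Qed.
Lemma hmulDr : right_distributive hmul hadd.
Proof. do 3!elim/cl_ind=> ?; rewrite !hE; apply/heqP; exact: heq_mulDr. Qed.

Section Evaluation.
Variables (A : algType K) (p : 'I_n.-1 -> A).

Fixpoint heval (t : hterm) : A :=
  match t with
  | HZero => 0 | HOne => 1 | HGen i => p i
  | HAdd t u => heval t + heval u
  | HMul t u => heval t * heval u
  | HScale a t => a *: heval t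
  end.

Definition hecke_rel : Prop :=
  [/\ forall i, p i * p i = p i,
      forall i j : 'I_n.-1, j = i.+1 :> nat -> p i * p j * p i = p j * p i * p j
    & forall i j : 'I_n.-1, (i.+1 < j)%N || (j.+1 < i)%N -> p i * p j = p j * p i].

Lemma heval_heq t u : hecke_rel -> heq t u -> heval t = heval u.
Proof.
move=> [quad braid comm]; elim=> {t u} //=; intros;
  rewrite ?(mulr1, mul1r, add0r, scaleN1r, addNr, mulrDl, mulrDr, addrA, mulrA,
    scalerA, scale1r, scalerDl, scalerDr, scalerAl, scalerAr) //;
  try congruence;
  by [exact: addrC | apply: braid | apply: comm | rewrite -scalerAl scalerAr].
Qed.

End Evaluation.

Lemma hone_neq0 : h1 != h0.
Proof.
have rel1 : hecke_rel (fun=> 1 : K^o) by split=> *; rewrite !mulr1.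
by apply/eqP => /heqP /(heval_heq rel1) /eqP; rewrite /= oner_eq0.
Qed.

HB.instance Definition _ :=
  GRing.Zmodule_isNzRing.Build hecke0 hmulA hmul1l hmul1r hmulDl hmulDr hone_neq0.

Lemma hscaleA a b x : hscale a (hscale b x) = hscale (a * b) x.
Proof. by elim/cl_ind: x => ?; rewrite !hE; apply/heqP; exact: heq_scaleA. Qed.
Lemma hscale1 : left_id 1 hscale.
Proof. by elim/cl_ind=> ?; rewrite !hE; apply/heqP; exact: heq_scale1. Qed.
Lemma hscaleDr : right_distributive hscale +%R.
Proof.
move=> a; do 2!elim/cl_ind=> ?; rewrite /GRing.add /= !hE; apply/heqP.
exact: heq_scaleDr.
Qed.
Lemma hscaleDl x : {morph hscale^~ x : a b / a + b}.
Proof.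
move=> a b; elim/cl_ind: x => ?; rewrite [in RHS]/GRing.add /= !hE; apply/heqP.
exact: heq_scaleDl.
Qed.
HB.instance Definition _ :=
  GRing.Zmodule_isLmodule.Build K hecke0 hscaleA hscale1 hscaleDr hscaleDl.

Lemma hscaleAl a (x y : hecke0) : a *: (x * y) = (a *: x) * y.
Proof.
rewrite /GRing.mul /GRing.scale /=; elim/cl_ind: x => ?; elim/cl_ind: y => ?.
by rewrite !hE; apply/heqP; exact: heq_scaleAl.
Qed.
HB.instance Definition _ := GRing.Lmodule_isLalgebra.Build K hecke0 hscaleAl.

Lemma hscaleAr a (x y : hecke0) : a *: (x * y) = x * (a *: y).
Proof.
rewrite /GRing.mul /GRing.scale /=; elim/cl_ind: x => ?; elim/cl_ind: y => ?.
by rewrite !hE; apply/heqP; exact: heq_scaleAr.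
Qed.
HB.instance Definition _ := GRing.Lalgebra_isAlgebra.Build K hecke0 hscaleAr.

Definition hpi (i : 'I_n.-1) : hecke0 := cl (HGen i).
Definition hpib (i : 'I_n.-1) : hecke0 := hpi i - 1.

Lemma hecke0_lift (A : algType K) (p : 'I_n.-1 -> A) : hecke_rel p ->
  exists f : {lrmorphism hecke0 -> A}, forall i, f (hpi i) = p i.
Proof.
move=> rel; pose f (x : hecke0) := heval p (rep x).
have fcl t : f (cl t) = heval p t by apply: heval_heq rel (rep_cl t).
have fD : zmod_morphism f.
  elim/cl_ind=> t; elim/cl_ind=> u; rewrite /GRing.add /GRing.opp /= !hE !fcl /=.
  by rewrite scaleN1r.
have fM : monoid_morphism f.
  split; first by rewrite -[1]/(cl HOne) fcl.
  by elim/cl_ind=> t; elim/cl_ind=> u; rewrite {1}/GRing.mul /= !hE !fcl.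
have fZ : scalable f.
  by move=> a; elim/cl_ind=> t; rewrite {1}/GRing.scale /= !hE !fcl.
pose fa := GRing.isZmodMorphism.Build _ _ f fD.
pose fm := GRing.isMonoidMorphism.Build _ _ f fM.
pose fs := GRing.isScalable.Build _ _ _ _ f fZ.
pose F : {lrmorphism hecke0 -> A} := HB.pack f fa fm fs.
by exists F => i; rewrite /= fcl.
Qed.

Definition piw (s : 'S_n) : hecke0 := \prod_(i <- redword s) hpi i.
Definition pibw (s : 'S_n) : hecke0 := \prod_(i <- redword s) hpib i.

End HeckeTerms.

Section Module.
Variables (K : comNzRingType) (n : nat) (sigma rho : 'S_n).

Definition intspace : Type := {ffun {x : 'S_n | x \in intervalL sigma rho} -> K^o}.
HB.instance Definition _ := GRing.Lmodule.copy intspace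
  {ffun {x : 'S_n | x \in intervalL sigma rho} -> K^o}.

(* The basis vector attached to [x]; it is 0 when [x] is not in the interval. *)
Definition bvec (x : 'S_n) : intspace := [ffun y => (val y == x)%:R].

Definition act_basis (i : 'I_n.-1) (x : 'S_n) : intspace :=
  if i \in DesL x then bvec x
  else if adj i \oP x \in intervalL sigma rho then bvec (adj i \oP x)
  else 0.

Definition act_gen (i : 'I_n.-1) (v : intspace) : intspace :=
  \sum_y v y *: act_basis i (val y).

Lemma act_gen_linear i : linear (act_gen i).
Proof.
move=> a u v; rewrite /act_gen scaler_sumr -big_split; apply: eq_bigr => y _ /=.
by rewrite !ffunE scalerDl scalerA.
Qed.
HB.instance Definition _ i := 
  GRing.isLinear.Build K intspace intspace _ (act_gen i) (act_gen_linear i).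

Lemma bvec_out x : x \notin intervalL sigma rho -> bvec x = 0.
Proof.
move=> nx; apply/ffunP => y; rewrite !ffunE; case: eqP => // e.
by move: (valP y); rewrite e (negbTE nx).
Qed.

Lemma bvec_sum (v : intspace) : v = \sum_y v y *: bvec (val y).
Proof.
apply/ffunP => y; rewrite sum_ffunE (bigD1 y) //= !ffunE eqxx.
rewrite big1 => [|z zy].
  by rewrite addr0; apply/esym/mulr1.
by rewrite !ffunE val_eqE eq_sym (negbTE zy) scaler0.
Qed.

Lemma act_gen_bvec_in i x : x \in intervalL sigma rho ->
  act_gen i (bvec x) = act_basis i x.
Proof.
move=> xI; pose y : {x | x \in intervalL sigma rho} := exist _ x xI.
rewrite /act_gen (bigD1 y) //= big1 ?addr0 => [|z zy]; rewrite ffunE.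
  by rewrite eqxx scale1r.
have -> : (val z == x) = false by apply: contraNF zy => /eqP e; apply/eqP/val_inj.
by rewrite scale0r.
Qed.

Lemma act_gen_bvec i x : leL sigma x -> act_gen i (bvec x) = bvec (dem i x).
Proof.
move=> sx; case: (boolP (x \in intervalL sigma rho)) => xI.
  rewrite act_gen_bvec_in // /act_basis DesLE /dem; case: ifP => // _.
  by case: ifP => // /negbT/bvec_out.
rewrite bvec_out // linear0 /dem bvec_out //; case: ifP => // d.
apply: contra xI; rewrite !inE sx /= => /andP[_].
by apply: leL_trans; apply: leL_adj; rewrite d.
Qed.

Lemma leL_dem i x : leL sigma x -> leL sigma (dem i x).
Proof.
move=> sx; rewrite /dem; case: ifP => // d; apply: leL_trans sx _.
by apply: leL_adj; rewrite d.
Qed.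

Lemma act_gen_ext (f g : {linear intspace -> intspace}) :
  (forall x, leL sigma x -> f (bvec x) = g (bvec x)) -> f =1 g.
Proof.
move=> fg v; rewrite (bvec_sum v) !linear_sum; apply: eq_bigr => y _.
rewrite !linearZ /=; congr (_ *: _); apply: fg.
by move: (valP y); rewrite inE => /andP[].
Qed.

Fixpoint act_term (t : hterm K n) (v : intspace) : intspace :=
  match t with
  | HZero => 0 | HOne => v | HGen i => act_gen i v
  | HAdd t u => act_term t v + act_term u v
  | HMul t u => act_term t (act_term u v)
  | HScale a t => a *: act_term t v
  end.

Lemma act_term_linear t : linear (act_term t).
Proof.
elim: t => [||i|t IHt u IHu|t IHt u IHu|b t IHt] a x y /=.
- by rewrite scaler0 addr0.
- by [].
- exact: linearP.
- by rewrite IHt IHu scalerDr !addrA; congr (_ + _); rewrite addrAC.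
- by rewrite IHu IHt.
- by rewrite IHt scalerDr !scalerA mulrC.
Qed.
HB.instance Definition _ t :=
  GRing.isLinear.Build K intspace intspace _ (act_term t) (act_term_linear t).

Lemma act_term_heq t u : heq t u -> act_term t =1 act_term u.
Proof.
elim=> {t u} /=.
- by [].
- by move=> t u _ IH v; rewrite IH.
- by move=> t u w _ IH1 _ IH2 v; rewrite IH1 IH2.
- by move=> t t' u u' _ IH1 _ IH2 v; rewrite IH1 IH2.
- by move=> t t' u u' _ IH1 _ IH2 v; rewrite IH1 IH2.
- by move=> a t t' _ IH v; rewrite IH.
- by move=> t u w v; rewrite addrA.
- by move=> t u v; rewrite addrC.
- by move=> t v; rewrite add0r.
- by move=> t v; rewrite scaleN1r addNr.
- by [].
- by [].
- by [].
- by [].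
- by move=> t u w v; rewrite linearD.
- by move=> a b t v; rewrite scalerA.
- by move=> t v; rewrite scale1r.
- by move=> a t u v; rewrite scalerDr.
- by move=> a b t v; rewrite scalerDl.
- by [].
- by move=> a t u v; rewrite linearZ.
- move=> i; apply: (act_gen_ext (f := act_gen i \o act_gen i) (g := act_gen i)) => x sx /=.
  by rewrite !act_gen_bvec ?leL_dem // dem_idem.
- move=> i j ij; apply: (act_gen_ext (f := act_gen i \o act_gen j \o act_gen i)
    (g := act_gen j \o act_gen i \o act_gen j)) => x sx /=.
  by rewrite !act_gen_bvec ?leL_dem // dem_braid.
- move=> i j ij; apply: (act_gen_ext (f := act_gen i \o act_gen j)
    (g := act_gen j \o act_gen i)) => x sx /=.
  by rewrite !act_gen_bvec ?leL_dem // dem_comm.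
Qed.

(* The same space, as a left module over the 0-Hecke algebra. *)
Definition wbim : Type := intspace.
HB.instance Definition _ := GRing.Zmodule.copy wbim intspace.

Definition hact (h : hecke0 K n) (v : wbim) : wbim := act_term (generic_quotient.repr h) v.

Lemma hact_cl t v : hact (\pi_(hecke0 K n)%qT t) v = act_term t v.
Proof. exact: act_term_heq (rep_cl t) v. Qed.

Local Notation cl := (\pi_(hecke0 K n)%qT).

Lemma hactA a b v : hact a (hact b v) = hact (a * b) v.
Proof.
rewrite -[a]generic_quotient.reprK -[b]generic_quotient.reprK.
by rewrite [_ * _](@hmul_cl K n) !hact_cl.
Qed.

Lemma hact1 : left_id 1 hact.
Proof. by move=> v; rewrite -[1]/(cl (HOne K n)) hact_cl. Qed.

Lemma hactDr : right_distributive hact +%R.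
Proof. by move=> a u v; apply: (linearD (act_term _)). Qed.

Lemma hactDl v : {morph hact^~ v : a b / a + b}.
Proof.
move=> a b; rewrite -[a]generic_quotient.reprK -[b]generic_quotient.reprK.
by rewrite [_ + _](@hadd_cl K n) !hact_cl.
Qed.

HB.instance Definition _ :=
  GRing.Zmodule_isLmodule.Build (hecke0 K n) wbim hactA hact1 hactDr hactDl.

Definition wbasis (x : 'S_n) : wbim := bvec x.

Lemma hpi_wbasis i x : x \in intervalL sigma rho ->
  hpi K i *: wbasis x = act_basis i x.
Proof. by move=> xI; rewrite [LHS]hact_cl /= act_gen_bvec_in. Qed.

(* Restricting the scalars of [wbim] to K gives back [intspace]. *)
Lemma wbim_scalar (c : K) (v : intspace) :
  (c%:A : hecke0 K n) *: (v : wbim) = c *: v.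
Proof.
by rewrite -[c%:A]/(hscale c (h1 K n)) (@hscale_cl K n) [LHS]hact_cl.
Qed.

End Module.

Section LeftIdeal.
Variables (A : nzRingType) (x : A).

(* The left ideal A x, with its structure of left A-module. *)
Definition lideal : {pred A^o} := [pred y | `[< exists a, y = a * x >]].

Lemma lidealP y : reflect (exists a, y = a * x) (y \in lideal).
Proof. exact: asboolP. Qed.

Fact lideal_submod_closed : submod_closed lideal.
Proof.
split; first by apply/lidealP; exists 0; rewrite mul0r.
move=> a _ _ /lidealP[b ->] /lidealP[c ->]; apply/lidealP; exists (a * b + c).
by rewrite mulrDl -mulrA.
Qed.
HB.instance Definition _ :=
  GRing.isSubmodClosed.Build A A^o lideal lideal_submod_closed.

Record lideal_mod : Type :=
  LIdeal { lideal_val :> A^o; lideal_valP : lideal_val \in lideal }.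
HB.instance Definition _ := [isSub for lideal_val].
HB.instance Definition _ := [Choice of lideal_mod by <:].
HB.instance Definition _ := [SubChoice_isSubLmodule of lideal_mod by <:].
End LeftIdeal.

Local Open Scope classical_set_scope.

(* The set [B] is a basis over K of the subspace [W] of [V]. *)
Definition set_basis (K : nzRingType) (V : lmodType K) (W B : set V) : Prop :=
  [/\ B `<=` W,
      forall (s : seq V) (c : V -> K), uniq s -> (forall v, v \in s -> B v) ->
        \sum_(v <- s) c v *: v = 0 -> forall v, v \in s -> c v = 0
    & forall w, W w -> exists (s : seq V) (c : V -> K),
        (forall v, v \in s -> B v) /\ w = \sum_(v <- s) c v *: v].

(* Main.v *)
From HB Require Import structures.
Require Import Defs.
From mathcomp Require Import all_boot all_order all_fingroup all_algebra.
From mathcomp Require Import boolp classical_sets reals.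
From mathcomp Require Import complex.
From mathcomp Require Import zify.

Set Implicit Arguments.
Unset Strict Implicit.
Unset Printing Implicit Defensive.

Import GRing.Theory.
Local Open Scope ring_scope.

(** Write [X g r] for [pi_g * pib_r], called [pipib g r] below.  Everything
    follows from the way the generators multiply [X g r] on the left, and the
    key is to see [X g r] as a product over a reduced word of [g r].

    Let [i_1 ... i_p] be a reduced word of [x] and let [u] be any permutation.
    The word lists the inversions of [x^-1] one by one.  Put [pi_(i_k)] at the
    places where the corresponding pair is also an inversion of [u^-1], and
    [pib_(i_k)] at the other places.  The product [mixed] of these letters
    depends on [x] and [u] only ([mixed_reduced]).  As in Matsumoto's theorem
    this reduces to braid moves.  A braid move of length three reverses the order
    in which the three pairs from three values are met, and as these pairs are
    compared by a linear order, six of the eight patterns of letters occur; for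
    each of the six the braid relation holds, whereas it fails for
    [pi pib pi] and [pib pi pib].

    When [ell (g r) = ell g + ell r], the product [X g r] is [mixed] for
    [x = g r] and [u = g] ([pipib_mixed]).  So if [i] is a left descent of [g r]
    but not of [g], a reduced word of [g r] starting with [i] shows that [X g r]
    starts with [pib_i] and is killed by [pi_i] ([hpi_pipib_des]).  It follows
    that [X g r = 0] when lengths do not add ([pipib_eq0]), because [X g r] is
    built from the right by letters of [g] and the first failure of additivity
    gives zero.  Conversely, let the algebra act on the permutations by Demazure
    products: [X g r] sends the identity to [g r] plus elements that are shorter
    ([leads_pipib]), hence it is nonzero, and for a fixed [r] the elements
    [X g r] with additive lengths are linearly independent.

    Finally [g] lies below [w0 r^-1] in the left weak order exactly when the
    lengths of [g] and [r] add ([leL_w0V]).  Hence, for [rho = w0 tau^-1], the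
    linear map [emb] sending a basis vector [g] of the interval module to
    [X g tau] commutes with the generators: leaving the interval corresponds to
    a loss of additivity, and both sides are then zero.  It is injective by the
    triangularity above and its image is the left ideal generated by its value
    at [sigma].  The isomorphism is the case [tau = rho^-1 w0], the basis the
    case in which [tau] is the permutation [rho] of the theorem. *)

(** * Lengths and the left weak order *)

Lemma pcompM n (s t : 'S_n) : s \oP t = (t * s)%g.
Proof. by []. Qed.

Section Lengths.
Variable n : nat.
Implicit Types (x y g r t u : 'S_n) (i j : 'I_n.-1) (w v : seq 'I_n.-1).

Lemma ell1 : ell (1%g : 'S_n) = 0%N.
Proof. by rewrite ell_inv inv1. Qed.

Lemma ell_adj_ndes i x : ~~ des x i -> ell (adj i \oP x) = (ell x).+1.
Proof. by move=> d; rewrite !ell_inv inv_adj. Qed.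

Lemma ell_adj_des i x : des x i -> ell x = (ell (adj i \oP x)).+1.
Proof. by move=> d; rewrite -(@ell_adj_ndes i) ?adjK // des_adj d. Qed.

Lemma ell_dem i x : (ell (dem i x) <= (ell x).+1)%N.
Proof. by rewrite /dem; case: ifP => // /negbT/ell_adj_ndes ->. Qed.

Lemma ell_wprod w : (ell (wprod w) <= size w)%N.
Proof. by rewrite ell_inv inv_wprod. Qed.

Lemma wprod_rev w : wprod (rev w) = ((wprod w)^-1)%g.
Proof.
elim: w => [|i w IH]; first by rewrite invg1.
by rewrite rev_cons -cats1 wprod_cat IH /= !pcompM invMg mul1g /adj tpermV.
Qed.

Lemma ellV x : ell (x^-1)%g = ell x.
Proof.
have le y : (ell (y^-1)%g <= ell y)%N.
  have [e <-] := redwordP y.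
  by rewrite -{1}e -wprod_rev -[leqRHS]size_rev ell_wprod.
by apply/eqP; rewrite eqn_leq le -{1}[x]invgK le.
Qed.

Definition reduced w := size w == ell (wprod w).

Lemma reduced_cons i w : reduced (i :: w) = reduced w && ~~ des (wprod w) i.
Proof.
rewrite /reduced /=; case: (boolP (des _ _)) => d; last first.
  by rewrite ell_adj_ndes // eqSS andbT.
by rewrite andbF; have := ell_adj_des d; have := ell_wprod w; lia.
Qed.

Lemma reduced_redword x : reduced (redword x).
Proof. by have [e1 e2] := redwordP x; rewrite /reduced e1 e2. Qed.

Lemma des_w0 i : des (w0 n) i.
Proof.
rewrite /w0; case: arg_maxnP => // m _ mmax.
apply/negPn/negP => /ell_adj_ndes e.
by have := mmax (adj i \oP m) isT; rewrite /= e ltnn.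
Qed.

(** Every position is a descent of [w0], so [w0] is the order-reversing
    permutation, which complements inversion sets. *)
Lemma w0V_anti (a b : 'I_n) :
  (a < b)%N -> ((w0 n)^-1%g b < (w0 n)^-1%g a)%N.
Proof.
case: a b => [a ha] [b hb] /=; elim: b hb => // b IH hb ab.
have hb' : (b < n)%N by lia.
have hi0 : (b < n.-1)%N by lia.
have := des_w0 (Ordinal hi0); rewrite /des.
have -> : lo (Ordinal hi0) = Ordinal hb' by exact: val_inj.
have -> : hi (Ordinal hi0) = Ordinal hb by exact: val_inj.
move=> d; move: ab; rewrite ltnS leq_eqVlt => /orP[/eqP e|/(IH hb')]; last by lia.
by have -> : Ordinal ha = Ordinal hb' by exact: val_inj.
Qed.

Lemma w0_anti (a b : 'I_n) : (w0 n a < w0 n b)%N = (b < a)%N.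
Proof.
case: (ltngtP (w0 n a) (w0 n b)) => [/w0V_anti|/w0V_anti|/val_inj/perm_inj ->];
  by rewrite ?permK ?ltnn // => ?; apply/esym; lia.
Qed.

Lemma ell_w0_comp x : (ell (w0 n \oP x) + ell x)%N = ell (w0 n).
Proof.
pose A := [set p : 'I_n * 'I_n | (p.1 < p.2)%N].
have key y : (ell (w0 n \oP y) + ell y)%N = #|A|.
  rewrite !ell_inv -(cardsID [set p : 'I_n * 'I_n | (y p.2 < y p.1)%N] A) addnC.
  congr (_ + _)%N; apply: eq_card => -[a b]; rewrite !inE //=.
  rewrite !pcompE w0_anti andbC -leqNgt; case: (ltngtP (y a) (y b)) => //=.
  by move=> /val_inj/perm_inj ->; rewrite ltnn.
by rewrite key -(key 1%g) ell1 addn0 pcompM mul1g.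
Qed.

Lemma ell_w0V x : (ell (w0 n \oP x^-1)%g + ell x)%N = ell (w0 n).
Proof. by rewrite -(ellV x) ell_w0_comp. Qed.

Definition length_additive g r := ell (g \oP r) == (ell g + ell r)%N.

Lemma leLE x y : leL x y = (ell y == ell (y \oP x^-1)%g + ell x)%N.
Proof.
apply/existsP/idP => [[t /andP[/eqP ->]]|e].
  by rewrite !pcompM mulKg.
by exists (y \oP x^-1)%g; rewrite e pcompM mulKVg eqxx.
Qed.

(** Complementing by [w0] turns the length condition of the weak order into
    additivity: [ell (w0 r^-1) = ell w0 - ell r], and the quotient of
    [w0 r^-1] by [g] is [w0 (g r)^-1], of length [ell w0 - ell (g r)]. *)
Lemma leL_w0V g r : leL g (w0 n \oP r^-1)%g = length_additive g r.
Proof.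
rewrite leLE /length_additive.
have -> : (w0 n \oP r^-1 \oP g^-1 = w0 n \oP (g \oP r)^-1)%g.
  by rewrite !pcompM invMg mulgA.
by have := ell_w0V r; have := ell_w0V (g \oP r); lia.
Qed.

Lemma leL1 x : leL 1%g x.
Proof. by rewrite leLE invg1 ell1 addn0 pcompM mul1g. Qed.

Lemma leL_refl x : leL x x.
Proof. by rewrite leLE pcompM mulVg ell1. Qed.

Lemma leL_w0 x : leL x (w0 n).
Proof. by rewrite leLE ell_w0V. Qed.

Lemma adj_comm i j x : (i.+1 < j)%N || (j.+1 < i)%N ->
  adj i \oP (adj j \oP x) = adj j \oP (adj i \oP x).
Proof.
move=> far; rewrite !pcompA; congr (_ \oP x); rewrite !pcompM [RHS]conjgC tpermJ.
by rewrite !tpermD // -val_eqE /=; lia.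
Qed.

Lemma adj_braid i j x : j = i.+1 :> nat ->
  adj i \oP (adj j \oP (adj i \oP x)) = adj j \oP (adj i \oP (adj j \oP x)).
Proof.
move=> e.
have elo : lo j = hi i by apply: val_inj.
have n1 : (lo i == hi j) = false by rewrite -val_eqE /=; lia.
have n2 : (hi i == hi j) = false by rewrite -val_eqE /=; lia.
have n3 := lo_neq_hi i.
rewrite !pcompA; congr (_ \oP x); rewrite !pcompM /adj elo !mulgA.
rewrite -[X in (X * _ * _)%g]tpermV -mulgA -conjgE tpermJ tpermR.
rewrite -[X in _ = (X * _ * _)%g]tpermV -[RHS]mulgA -conjgE tpermJ tpermL.
by rewrite !tpermD ?n1 ?n2 // eq_sym ?n1 ?n3.
Qed.

(** The three values [a], [b], [c] of [u^-1] are compared in the order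
    [(a,b)], [(a,c)], [(b,c)] along the word [i j i], and in the reverse order
    along [j i j]. *)
Lemma des_braid i j u (f := (u^-1)%g) (a := f (lo i)) (b := f (hi i)) (c := f (hi j)) :
  j = i.+1 :> nat ->
  [/\ des u i = (b < a)%N, des (adj i \oP u) j = (c < a)%N,
      des (adj j \oP (adj i \oP u)) i = (c < b)%N &
   [/\ des u j = (c < b)%N, des (adj j \oP u) i = (c < a)%N &
      des (adj i \oP (adj j \oP u)) j = (b < a)%N]].
Proof.
move=> e.
have elo : lo j = hi i by apply: val_inj.
have n1 : (lo i == hi j) = false by rewrite -val_eqE /=; lia.
have n2 : (hi i == hi j) = false by rewrite -val_eqE /=; lia.
have n3 := lo_neq_hi i.
have ai : (adj i (lo i) = hi i) * (adj i (hi i) = lo i) * (adj i (hi j) = hi j).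
  by rewrite /adj tpermL tpermR tpermD ?n1 ?n2; do !split.
have aj : (adj j (lo i) = lo i) * (adj j (hi i) = hi j) * (adj j (hi j) = hi i).
  by rewrite /adj elo tpermL tpermR tpermD // 1?eq_sym ?n1 ?n3; do !split.
by do !split; rewrite /des ?adjVE ?elo ?(ai, aj).
Qed.

End Lengths.

(** * Matsumoto's theorem for mixed words *)

Section IdempotentBraids.
Variables (A : nzRingType) (p q : A).
Hypotheses (pp : p * p = p) (qq : q * q = q).

Lemma idem_comp_mul : p * (p - 1) = 0.
Proof. by rewrite mulrBr mulr1 pp subrr. Qed.

Hypothesis braid : p * q * p = q * p * q.

(** With [braid_pbb] and [braid_bbb], and with the relations in which [p] and
    [q] are exchanged, these are the braid moves between words in which some of
    the letters are replaced by [p - 1] or [q - 1]. *)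
Lemma braid_ppb : p * q * (p - 1) = (q - 1) * p * q.
Proof. by rewrite mulrBr mulr1 2!mulrBl mul1r braid. Qed.

Lemma braid_pbb : p * (q - 1) * (p - 1) = (q - 1) * (p - 1) * q.
Proof.
rewrite !(mulrBl, mulrBr, mulr1, mul1r) pp qq braid.
by rewrite !opprB !addrA !subrK.
Qed.

Lemma braid_bbb : (p - 1) * (q - 1) * (p - 1) = (q - 1) * (p - 1) * (q - 1).
Proof.
by rewrite [RHS]mulrBr mulr1 -braid_pbb [(p - 1) * (q - 1)]mulrBl mul1r mulrBl.
Qed.

End IdempotentBraids.

Section Mixed.
Variables (K : comNzRingType) (n : nat).
Implicit Types (x y g r t u : 'S_n) (i j : 'I_n.-1) (w v : seq 'I_n.-1).
Local Notation H := (hecke0 K n).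
Local Notation hpi := (@hpi K n).
Local Notation hpib := (@hpib K n).
Local Notation cl := (\pi_(hecke0 K n)%qT).

Lemma hpi_idem i : hpi i * hpi i = hpi i.
Proof. by rewrite [LHS](@hmul_cl K n); apply/heqP/heq_quad. Qed.

Lemma hpi_braid i j : j = i.+1 :> nat ->
  hpi i * hpi j * hpi i = hpi j * hpi i * hpi j.
Proof.
move=> ij; rewrite ![hpi _ * hpi _](@hmul_cl K n) ![cl _ * _](@hmul_cl K n).
by apply/heqP/heq_braid.
Qed.

Lemma hpi_comm i j : (i.+1 < j)%N || (j.+1 < i)%N -> GRing.comm (hpi i) (hpi j).
Proof.
by move=> far; rewrite /GRing.comm ![hpi _ * _](@hmul_cl K n); apply/heqP/heq_comm.
Qed.

Lemma hpi_hpib i : hpi i * hpib i = 0.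
Proof. exact/idem_comp_mul/hpi_idem. Qed.

Definition letter (b : bool) i : H := if b then hpi i else hpib i.

Lemma letter_comm b c i j : (i.+1 < j)%N || (j.+1 < i)%N ->
  letter b i * letter c j = letter c j * letter b i.
Proof.
move=> far; have cij := hpi_comm far.
have cjb : GRing.comm (hpib i) (hpi j).
  by apply/commr_sym/commrB; [exact: commr_sym | exact: commr1].
by case: b c => [] [] //; apply/commrB => //; apply: commr1.
Qed.

(** The marks come from comparing three distinct numbers.  By transitivity the
    patterns [pi pib pi] and [pib pi pib], for which the identity is false, do
    not occur. *)
Lemma letter_braid (a b c : nat) i j : j = i.+1 :> nat ->
  uniq [:: a; b; c] ->
  letter (b < a)%N i * letter (c < a)%N j * letter (c < b)%N i =
  letter (c < b)%N j * letter (c < a)%N i * letter (b < a)%N j.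
Proof.
move=> ij abc; have br := hpi_braid ij; have br' := esym br.
have [pi pj] := (hpi_idem i, hpi_idem j).
rewrite /letter; case: (ltnP b a) => ba; case: (ltnP c a) => ca; case: (ltnP c b) => cb.
- exact: br.
- exact: braid_ppb.
- by move: abc => /=; rewrite !inE; lia.
- exact: braid_pbb.
- by rewrite /hpib -(braid_ppb br').
- by move: abc => /=; rewrite !inE; lia.
- by rewrite /hpib -(braid_pbb pj pi br').
- exact: braid_bbb.
Qed.

Lemma uniq_braid i j u : j = i.+1 :> nat ->
  uniq (map (fun k => val ((u^-1)%g k)) [:: lo i; hi i; hi j]).
Proof.
move=> ij; rewrite map_inj_uniq => [|k l /val_inj/perm_inj //].
by rewrite /= !inE -!val_eqE /=; lia.
Qed.

(** The [k]-th letter is [pi] or [pib] according to whether the [k]-th inversion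
    met by the word [w] is also one of [u^-1]; passing to [adj i \oP u] transports the
    remaining inversions along with the word.  For reduced [w], taking
    [u = wprod w] marks all the letters [pi], and [u = 1] marks them all
    [pib]. *)
Fixpoint mixed w u : H :=
  if w is i :: w' then letter (des u i) i * mixed w' (adj i \oP u) else 1.

Lemma mixed_cat w v u :
  mixed (w ++ v) u = mixed w u * mixed v ((wprod w)^-1 \oP u)%g.
Proof.
elim: w u => [|i w IH] u /=; first by rewrite mul1r invg1 pcompM mulg1.
by rewrite IH mulrA; congr (_ * mixed v _); rewrite !pcompM invMg mulgA /adj tpermV.
Qed.

Lemma reduced_uncons i w : reduced (i :: w) ->
  [/\ reduced w, des (wprod (i :: w)) i & wprod w = adj i \oP wprod (i :: w)].
Proof.
by rewrite reduced_cons => /andP[rw d]; rewrite /= des_adj d adjK.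
Qed.

Lemma reduced_cons_des i x w : des x i -> reduced w -> wprod w = adj i \oP x ->
  reduced (i :: w).
Proof. by move=> d rw e; rewrite reduced_cons rw e des_adj d. Qed.

(** By induction on the length.  Two reduced words of [x] that start with
    different letters [i] and [j] are compared, by the induction hypothesis, to
    words starting with [i j] and [j i], or [i j i] and [j i j], and having a
    common tail: these exist because [i] and [j] are both descents of [x]. *)
Theorem mixed_reduced w v u : reduced w -> reduced v -> wprod w = wprod v ->
  mixed w u = mixed v u.
Proof.
have [m] := ubnP (size w); elim: m => // m IHm in w v u *.
move=> sw rw rv e; set x := wprod w in e.
have ex : (ell x <= m)%N by rewrite -(eqP rw).
(* [T i] is the value of any reduced word of [x] that starts with [i]. *)
pose T i := letter (des u i) i * mixed (redword (adj i \oP x)) (adj i \oP u).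
have IH y w1 w2 u' : (ell y < m)%N -> reduced w1 -> reduced w2 ->
    wprod w1 = y -> wprod w2 = y -> mixed w1 u' = mixed w2 u'.
  move=> ym r1 r2 e1 e2; apply: IHm; rewrite ?e1 ?e2 //.
  by rewrite (eqP r1) e1.
have down i y : des y i -> (ell y <= m)%N -> (ell (adj i \oP y) < m)%N.
  by move=> /ell_adj_des ->.
have red i : wprod (redword (adj i \oP x)) = adj i \oP x.
  by have [] := redwordP (adj i \oP x).
have headT i w' : reduced (i :: w') -> wprod (i :: w') = x ->
    mixed (i :: w') u = T i.
  move=> /reduced_uncons[rw' dx ew'] e'.
  rewrite e' in dx ew'; rewrite /= /T; congr (_ * _).
  by apply: (IH (adj i \oP x)); rewrite ?reduced_redword ?red // down.
have Tfar i j : (i.+1 < j)%N || (j.+1 < i)%N -> des x i -> des x j -> T i = T j.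
  move=> far di dj; have far' : (j.+1 < i)%N || (i.+1 < j)%N by rewrite orbC.
  pose y := adj j \oP (adj i \oP x); pose t := redword y.
  have [et _] := redwordP y; have rt := reduced_redword y.
  have [dij dji] : des (adj i \oP x) j /\ des (adj j \oP x) i by rewrite !des_far.
  have Tij : T i = letter (des u i) i * mixed (j :: t) (adj i \oP u).
    congr (_ * _); apply: (IH (adj i \oP x)); rewrite ?reduced_redword ?red ?down //.
      exact: (reduced_cons_des dij).
    by rewrite /= et adjK.
  have Tji : T j = letter (des u j) j * mixed (i :: t) (adj j \oP u).
    congr (_ * _); apply: (IH (adj j \oP x)); rewrite ?reduced_redword ?red ?down //.
      by apply: (reduced_cons_des dji); rewrite // et adj_comm.
    by rewrite /= et adj_comm // adjK.
  by rewrite Tij Tji /= !des_far // !mulrA (letter_comm _ _ far) adj_comm.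
have Tadj i j : j = i.+1 :> nat -> des x i -> des x j -> T i = T j.
  move=> ij di dj.
  pose y := adj i \oP (adj j \oP (adj i \oP x)); pose t := redword y.
  have ey : y = adj j \oP (adj i \oP (adj j \oP x)) by exact: adj_braid.
  have [et _] := redwordP y; have rt := reduced_redword y.
  have [d1 d2 d3 [d4 d5 d6]] := des_braid x ij.
  have d : des (adj i \oP x) j.
    by move: di dj; rewrite d1 d2 d4 => ba cb; apply: ltn_trans cb ba.
  have d' : des (adj j \oP x) i by rewrite d5 -d2.
  rewrite -d3 in d4; rewrite d4 in dj; rewrite -d6 in d1; rewrite d1 in di.
  have Tij : T i = letter (des u i) i * mixed [:: j, i & t] (adj i \oP u).
    congr (_ * _); apply: (IH (adj i \oP x)); rewrite ?reduced_redword ?red //.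
    - by rewrite down // d1.
    - apply: (reduced_cons_des d); rewrite /= ?et ?adjK //.
      by apply: (reduced_cons_des dj); rewrite /= ?et.
    - by rewrite /= et !adjK.
  have Tji : T j = letter (des u j) j * mixed [:: i, j & t] (adj j \oP u).
    congr (_ * _); apply: (IH (adj j \oP x)); rewrite ?reduced_redword ?red //.
    - by rewrite down // d4.
    - apply: (reduced_cons_des d'); rewrite /= ?et ?ey ?adjK //.
      by apply: (reduced_cons_des di); rewrite /= ?et.
    - by rewrite /= et ey !adjK.
  have [b1 b2 b3 [b4 b5 b6]] := des_braid u ij.
  have abc := uniq_braid u ij.
  rewrite Tij Tji /= b1 b2 b3 b4 b5 b6 !mulrA adj_braid //.
  by rewrite (letter_braid ij abc).
have TE i j : des x i -> des x j -> T i = T j.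
  move=> di dj; case: (ltngtP i j) => [ij|ji|/val_inj -> //].
    by case: (ltngtP i.+1 j) ij => // [far|/esym adj] _; [apply: Tfar; rewrite ?far | apply: Tadj].
  by case: (ltngtP j.+1 i) ji => // [far|/esym adj] _; [apply: Tfar; rewrite ?far ?orbT | apply/esym/Tadj].
case: w v @x sw rw rv e ex @T IH down red headT {Tfar Tadj} TE => [|i w] [|j v] //.
- by rewrite {2}/reduced => x _ _ /eqP + e; rewrite -e ell1.
- by rewrite {1}/reduced => x _ /eqP + _ e; rewrite -/x e ell1.
move=> x _ rw rv e ex T _ _ _ headT TE; rewrite !headT //; apply: TE.
  by have [] := reduced_uncons rw.
by have [_] := reduced_uncons rv; rewrite -e.
Qed.

End Mixed.

(** * The products [pi_g * pib_r] *)

Section Products.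
Variables (K : comNzRingType) (n : nat).
Implicit Types (x y g r t u : 'S_n) (i j : 'I_n.-1) (w v : seq 'I_n.-1).
Local Notation H := (hecke0 K n).
Local Notation hpi := (@hpi K n).
Local Notation hpib := (@hpib K n).
Local Notation piw := (@piw K n).
Local Notation pibw := (@pibw K n).

Lemma mixed_full w : reduced w -> mixed K w (wprod w) = \prod_(i <- w) hpi i.
Proof.
elim: w => [|i w IH] rw; first by rewrite big_nil.
have [rw' d _] := reduced_uncons rw.
by rewrite big_cons [LHS]/= adjK IH // [des _ _]d.
Qed.

(** When the lengths of [(wprod w)^-1] and [u] add, [w] and [u] have no
    inversion in common. *)
Lemma mixed_additive w u : ell ((wprod w)^-1 \oP u)%g = (size w + ell u)%N ->
  mixed K w u = \prod_(i <- w) hpib i.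
Proof.
elim: w u => [|i w IH] u; first by rewrite big_nil.
have -> : ((wprod (i :: w))^-1 \oP u = (wprod w)^-1 \oP (adj i \oP u))%g.
  by rewrite /= !pcompM invMg mulgA /adj tpermV.
move=> e; have le := ell_comp ((wprod w)^-1)%g (adj i \oP u).
have d : ~~ des u i.
  apply/negP => /ell_adj_des eu; move: le; rewrite e eu ellV /=.
  by have := ell_wprod w; lia.
rewrite /= (negbTE d) big_cons IH // e (ell_adj_ndes d) /=; lia.
Qed.

Lemma piw_word w : reduced w -> \prod_(i <- w) hpi i = piw (wprod w).
Proof.
move=> rw; have [e _] := redwordP (wprod w).
rewrite -mixed_full // /Defs.piw -mixed_full ?reduced_redword // e.
by apply: mixed_reduced; rewrite ?reduced_redword.
Qed.

Lemma reduced_redword_cat g r : length_additive g r -> reduced (redword g ++ redword r).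
Proof.
have [eg sg] := redwordP g; have [er sr] := redwordP r.
by rewrite /reduced size_cat wprod_cat eg er sg sr eq_sym.
Qed.

Lemma piw_comp g r : length_additive g r -> piw (g \oP r) = piw g * piw r.
Proof.
move=> a; have [eg _] := redwordP g; have [er _] := redwordP r.
rewrite -{1}eg -{1}er -wprod_cat -piw_word ?big_cat //.
exact: reduced_redword_cat.
Qed.

Lemma hpi_piw i x : hpi i * piw x = piw (dem i x).
Proof.
have nd y : ~~ des y i -> hpi i * piw y = piw (adj i \oP y).
  move=> d; have [e _] := redwordP y.
  rewrite -{2}e -[_ \oP _]/(wprod (i :: redword y)) -piw_word ?big_cons //.
  by rewrite reduced_cons reduced_redword e.
rewrite /dem; case: ifP => [d|/negbT/nd //].
have := nd (adj i \oP x); rewrite des_adj d adjK => /(_ isT) <-.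
by rewrite mulrA hpi_idem.
Qed.

Definition pipib g r : H := piw g * pibw r.

(** Concatenate reduced words of [g] and [r]: all letters of the first are
    inversions of [g], and none of the second. *)
Lemma pipib_mixed g r w : length_additive g r -> reduced w -> wprod w = g \oP r ->
  pipib g r = mixed K w g.
Proof.
move=> a rw e; have [eg _] := redwordP g; have [er sr] := redwordP r.
rewrite (@mixed_reduced K n w (redword g ++ redword r) g) //; last 2 first.
- exact: reduced_redword_cat.
- by rewrite wprod_cat eg er.
rewrite mixed_cat eg pcompM mulgV (@mixed_additive (redword r)); last first.
  by rewrite er ell1 addn0 sr pcompM mul1g ellV.
by have := mixed_full (reduced_redword g); rewrite eg => ->.
Qed.

Lemma hpi_pipib i g r : hpi i * pipib g r = pipib (dem i g) r.
Proof. by rewrite mulrA hpi_piw. Qed.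

(** A reduced word of [g r] that starts with [i] shows that the product is
    [pib_i] times something, and [pi_i * pib_i = 0]. *)
Lemma hpi_pipib_des i g r : length_additive g r -> ~~ des g i -> des (g \oP r) i ->
  hpi i * pipib g r = 0.
Proof.
move=> a ng d; have [e _] := redwordP (adj i \oP (g \oP r)).
rewrite (@pipib_mixed g r (i :: redword (adj i \oP (g \oP r)))) //.
- by rewrite /= (negbTE ng) mulrA hpi_hpib mul0r.
- exact: reduced_cons_des d (reduced_redword _) e.
- by rewrite /= e adjK.
Qed.

Lemma additive_adj i g r : ~~ des g i -> length_additive g r ->
  length_additive (adj i \oP g) r = ~~ des (g \oP r) i.
Proof.
move=> ng /eqP a; rewrite /length_additive -pcompA (ell_adj_ndes ng).
case: (boolP (des _ _)) => [/ell_adj_des|/ell_adj_ndes]; lia.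
Qed.

(** Multiply [pib_r] by the letters of [g] from right to left.  The first one
    that destroys the additivity is a descent of the current product of [g'] and
    [r], but not of [g']. *)
Lemma pipib_eq0 g r : ~~ length_additive g r -> pipib g r = 0.
Proof.
have [m] := ubnP (ell g); elim: m g => // m IH g gm na.
case: (pickP (des g)) => [i d|nd]; last first.
  move: na; rewrite (no_des (fun i => negbT (nd i))) /length_additive pcompM mulg1.
  by rewrite ell1 eqxx.
pose g' := adj i \oP g; have ng' : ~~ des g' i by rewrite des_adj d.
have -> : g = dem i g' by rewrite /dem (negbTE ng') adjK.
rewrite -hpi_pipib; case: (boolP (length_additive g' r)) => a; last first.
  by rewrite IH ?mulr0 //; have := ell_adj_des d; rewrite -/g'; lia.
apply: hpi_pipib_des => //; rewrite -[des _ _]negbK -additive_adj //.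
by rewrite adjK.
Qed.

End Products.

(** * Leading terms *)

Section Triangular.
Variables (K : comNzRingType) (n : nat).
Implicit Types (x y g r t u : 'S_n) (i j : 'I_n.-1) (w v : seq 'I_n.-1).

(** The interval from 1 to [w0] contains all permutations, so its module is the
    action of the algebra on all permutations by Demazure products. *)
Fact all_in x : x \in intervalL 1%g (w0 n).
Proof. by rewrite inE leL1 leL_w0. Qed.

Definition coef (f : intspace K 1%g (w0 n)) x : K := f (exist _ x (all_in x)).

(** The part of [f] of length at least [ell x] is the basis vector [x]. *)
Definition leads (f : intspace K 1%g (w0 n)) x :=
  forall z, (ell x <= ell z)%N -> coef f z = (z == x)%:R.

Lemma coef_act i f z : coef (act_gen i f) z =
  \sum_x coef f x * (z == dem i x)%:R.
Proof.
rewrite (reindex_onto (fun y : {x | x \in intervalL 1%g (w0 n)} => val y)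
  (fun x => exist _ x (all_in x))) //=.
rewrite {1}(bvec_sum f) linear_sum /coef sum_ffunE; apply: eq_big => y.
  by apply/esym/eqP/val_inj.
move=> _; rewrite linearZ /= act_gen_bvec ?leL1 // !ffunE /=.
by congr (f _ * _); apply: val_inj.
Qed.

(** An element [y] other than [x] cannot contribute to [z]: [dem i y = z] with
    [ell z > ell x] forces [ell y >= ell x], where [f] vanishes except at
    [x]. *)
Lemma leads_act i f x : ~~ des x i -> leads f x ->
  forall z, (ell x < ell z)%N -> coef (act_gen i f) z = (z == adj i \oP x)%:R.
Proof.
move=> nd lf z xz; rewrite coef_act (bigD1 x) //= lf // eqxx mul1r.
rewrite {1}/dem (negbTE nd) big1 ?addr0 // => y yx.
case: (eqP (x := z)) => [ez|]; last by rewrite mulr0.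
rewrite lf ?(negbTE yx) ?mul0r //.
by have := ell_dem i y; rewrite -ez; lia.
Qed.

(** The letters [pi_i] and [pib_i = pi_i - 1] have the same effect above the
    length of the current leading element. *)
Lemma leads_mixed w u : reduced w ->
  leads (hact (mixed K w u) (bvec K _ _ 1%g)) (wprod w).
Proof.
elim: w => [|i w IH] in u *.
  move=> _ z _; rewrite /= hact1 /coef ffunE //=.
rewrite reduced_cons => /andP[/IH lw d] /= z; rewrite (ell_adj_ndes d) => wz.
have lf := lw (adj i \oP u); rewrite -hactA.
set f := hact (mixed _ _ _) _ in lf *.
have ef : hact (Defs.hpi K i) f = act_gen i f by rewrite hact_cl.
rewrite /letter; case: ifP => _; first by rewrite ef (leads_act d).
have -> : hact (Defs.hpib K i) f = act_gen i f - f.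
  have := scalerBl (Defs.hpi K i) 1 (f : wbim K 1%g (w0 n)).
  by rewrite scale1r -ef.
rewrite /coef !ffunE -!/(coef _ _) (leads_act d) // lf; last exact: ltnW.
have -> : (z == wprod w) = false by apply: contraTF wz => /eqP ->; rewrite ltnn.
by rewrite subr0.
Qed.

Lemma hact0 f : hact 0 f = 0 :> wbim K 1%g (w0 n).
Proof. exact: (scale0r (f : wbim K 1%g (w0 n))). Qed.

Lemma leads_pipib g r : length_additive g r ->
  leads (hact (pipib K g r) (bvec K _ _ 1%g)) (g \oP r).
Proof.
move=> a; have [e _] := redwordP (g \oP r).
rewrite (pipib_mixed K a (reduced_redword _) e) -{2}e.
exact/leads_mixed/reduced_redword.
Qed.

Lemma pipib_neq0 g r : length_additive g r -> pipib K g r != 0.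
Proof.
move=> /leads_pipib/(_ (g \oP r) (leqnn _)) lead; apply/eqP => t0.
by move/eqP: lead; rewrite t0 hact0 /coef ffunE eqxx eq_sym oner_eq0.
Qed.

End Triangular.

(** * The interval module as a left ideal *)

Section Embedding.
Variables (K : comNzRingType) (n : nat) (sigma rho tau : 'S_n).
Hypothesis rhoE : rho = (w0 n \oP tau^-1)%g.
Implicit Types (x g r t u : 'S_n) (i j : 'I_n.-1) (v : intspace K sigma rho).
Local Notation pipib := (@pipib K n).
Local Notation I := {x | x \in intervalL sigma rho}.
Local Notation cl := (\pi_(hecke0 K n)%qT).

Lemma mem_intervalL x :
  (x \in intervalL sigma rho) = leL sigma x && length_additive x tau.
Proof. by rewrite inE rhoE leL_w0V. Qed.

Lemma interval_val (y : I) :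
  leL sigma (val y) /\ length_additive (val y) tau.
Proof. by apply/andP; rewrite -mem_intervalL; exact: valP y. Qed.

Definition emb v : hecke0 K n := \sum_y (v y : K) *: pipib (val y) tau.

Lemma emb_linear : linear emb.
Proof.
move=> a f g; rewrite /emb scaler_sumr -big_split; apply: eq_bigr => y _ /=.
by rewrite !ffunE scalerDl scalerA.
Qed.
HB.instance Definition _ := GRing.isLinear.Build K _ _ _ emb emb_linear.

(** Outside the interval both sides vanish: there [bvec] is 0 by definition, and
    the right-hand side because the lengths do not add. *)
Lemma emb_bvec x : leL sigma x -> emb (bvec K sigma rho x) = pipib x tau.
Proof.
move=> sx; case: (boolP (x \in intervalL sigma rho)) => [xI|].
  rewrite /emb (bigD1 (exist _ x xI)) //= ffunE eqxx scale1r big1 ?addr0 // => y yx.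
  rewrite ffunE (_ : (val y == x) = false) ?scale0r //.
  by apply: contraNF yx => /eqP e; apply/eqP/val_inj.
move=> xI; rewrite bvec_out // linear0 pipib_eq0 //.
by apply: contra xI; rewrite mem_intervalL sx.
Qed.

Lemma emb_gen i v : emb (act_gen i v) = hpi K i * emb v.
Proof.
rewrite [in LHS](bvec_sum v) [in RHS](bvec_sum v).
rewrite (linear_sum (act_gen i)) !(linear_sum emb) mulr_sumr; apply: eq_bigr => y _.
have [sy _] := interval_val y.
rewrite /= [act_gen i _]linearZ !(linearZ_LR emb) /= act_gen_bvec // !emb_bvec ?leL_dem //.
by rewrite -scalerAr hpi_pipib.
Qed.

Lemma emb_hact h v : emb (hact h v) = h * emb v.
Proof.
rewrite -[h]generic_quotient.reprK hact_cl.
elim: (generic_quotient.repr h) v => [||i|t IHt u IHu|t IHt u IHu|a t IHt] v /=.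
- by rewrite linear0 [cl _](_ : _ = 0) ?mul0r.
- by rewrite [cl _](_ : _ = 1) ?mul1r.
- exact: emb_gen.
- by rewrite (linearD emb) /= IHt IHu -mulrDl [cl t + _](@hadd_cl K n).
- by rewrite IHt IHu mulrA [cl t * _](@hmul_cl K n).
- by rewrite (linearZ_LR emb) /= IHt scalerAl [a *: cl t](@hscale_cl K n).
Qed.

(** Among the elements in the support of [v], take [y] of maximal length.  As
    [ell (z tau) = ell z + ell tau] for all [z] in the interval, the coefficient
    of [y tau] in the image of the identity under [emb v] comes from [y]
    alone. *)
Lemma emb_inj : injective emb.
Proof.
apply: raddf_inj => v ev; apply/eqP; apply: contraT => v0.
have [y0 vy0] : exists y : I, v y != 0.
  apply/existsP; apply: contraNT v0; rewrite negb_exists => /forallP z.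
  by apply/eqP/ffunP => y; apply/eqP; move: (z y); rewrite negbK => /eqP ->; rewrite ffunE.
case: (@arg_maxnP _ y0 (fun y => v y != 0) (fun y => ell (val y)) vy0).
move=> y vy ymax.
have lead (z : I) : leads (hact (pipib (val z) tau) (bvec K _ _ 1%g)) (val z \oP tau).
  by have [_ az] := interval_val z; apply: leads_pipib.
have lz (z : I) : ell (val z \oP tau) = (ell (val z) + ell tau)%N.
  by have [_ /eqP] := interval_val z.
pose ev1 h := coef (hact h (bvec K _ _ 1%g)) (val y \oP tau).
have ev1E : ev1 (emb v) = v y.
  have ev1D : {morph ev1 : a b / a + b}.
    by move=> a b; rewrite /ev1 hactDl /coef ffunE.
  have ev1Z c a : ev1 (c *: a) = c * ev1 a.
    rewrite /ev1 -[c *: a]mul1r -scalerAr scalerAl -hactA.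
    by rewrite [hact _ _]wbim_scalar /coef ffunE.
  rewrite /emb (big_morph ev1 ev1D (_ : _ = 0)); last first.
    by rewrite /ev1 /coef hact0 ffunE.
  rewrite (bigD1 y) //= ev1Z /ev1 lead // eqxx mulr1 big1 ?addr0 // => z zy.
  have [->|vz] := eqVneq (v z) 0; first by rewrite -/(ev1 _) ev1Z mul0r.
  rewrite -/(ev1 _) ev1Z /ev1 lead; last by rewrite !lz leq_add2r; apply: ymax.
  rewrite (_ : (_ == _) = false) ?mulr0 //; apply: contraNF zy => /eqP.
  by rewrite !pcompM => /mulgI/val_inj ->.
move: vy; rewrite -ev1E ev /ev1 /coef hact0.
by rewrite ffunE eqxx.
Qed.

(** For [y] above [sigma], say [y = t sigma] with additive lengths,
    [pi_y = pi_t pi_sigma]. *)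
Lemma emb_ideal v : emb v \in lideal (piw K sigma * pibw K tau).
Proof.
rewrite /emb; elim/big_rec: _ => [|y h _ /lidealP[a ->]]; first exact: rpred0.
have [/existsP[t /andP[/eqP e /eqP a_t]] _] := interval_val y.
apply/lidealP; exists ((v y : K) *: piw K t + a); rewrite mulrDl /pipib; congr (_ + _).
by rewrite e piw_comp -?scalerAl ?mulrA // /length_additive -e a_t.
Qed.

(** If [sigma] is not below [rho], the interval is empty and so the ideal has to
    be zero; this is covered by [emb_bvec], as it holds at [sigma] in all
    cases. *)
Lemma emb_surj h : h \in lideal (piw K sigma * pibw K tau) -> exists v, emb v = h.
Proof.
move=> /lidealP[a ->]; exists (hact a (bvec K _ _ sigma)).
by rewrite emb_hact emb_bvec ?leL_refl.
Qed.

(** The basis is the image under [emb] of the basis of the interval module.  The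
    distinctness of its elements, which lets a family indexed by permutations be
    handled as a set of vectors, also comes from the injectivity of [emb]. *)
Lemma lideal_basis :
  set_basis (K := K) [set h | h \in lideal (piw K sigma * pibw K tau)]%classic
    [set piw K gamma * pibw K tau | gamma in
       [set gamma | gamma \in intervalL sigma rho]%classic]%classic.
Proof.
split.
- move=> _ [g gI <-] /=.
  have := emb_ideal (bvec K sigma rho g).
  by rewrite emb_bvec //; move: gI; rewrite /= mem_intervalL => /andP[].
- move=> s c us sB s0.
  have /choice[f fP] : forall h : hecke0 K n, exists g,
      h \in s -> g \in intervalL sigma rho /\ pipib g tau = h.
    move=> h; have [/sB[g gI <-]|_] := boolP (h \in s); last by exists 1%g.
    by exists g.
  pose v := \sum_(h <- s) c h *: bvec K sigma rho (f h).
  have v0 : v = 0.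
    apply: emb_inj; rewrite linear0 -[RHS]s0 /v (linear_sum emb) !big_seq.
    apply: eq_bigr => h /fP[fI fh].
    have [sf _] := interval_val (exist _ (f h) fI).
    by rewrite (linearZ_LR emb) /= emb_bvec // fh.
  move=> h hs; have [fI fh] := fP h hs.
  have := congr1 (fun v : intspace K sigma rho => v (exist _ (f h) fI)) v0.
  rewrite /v sum_ffunE (bigD1_seq h) //= !ffunE eqxx big_seq_cond big1.
    by rewrite addr0 /= => <-; rewrite -[LHS]mulr1.
  move=> k /andP[ks kh]; rewrite !ffunE.
  rewrite (_ : (_ == _) = false) ?scaler0 //; apply: contraNF kh => /eqP /= e.
  by have [_ <-] := fP k ks; rewrite -e fh.
- move=> h /= /emb_surj[v <-].
  have inj : injective (fun y : I => pipib (val y) tau).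
    move=> y z; have [[sy _] [sz _]] := (interval_val y, interval_val z).
    rewrite -!emb_bvec // => /emb_inj /ffunP /(_ y); rewrite !ffunE eqxx.
    by case: eqP => [/val_inj //|_ /eqP]; rewrite oner_eq0.
  exists [seq pipib (val y) tau | y <- enum {: I}].
  have /choice[c cP] : forall h : hecke0 K n, exists a : K,
      forall y : I, pipib (val y) tau = h -> a = v y.
    move=> k; have [[y ky]|nk] := EM (exists y : I, pipib (val y) tau = k).
      by exists (v y) => z; rewrite -ky => /inj ->.
    by exists 0 => y ky; case: nk; exists y.
  exists c; split.
    move=> k /mapP[y _ ->]; exists (val y) => //; exact: (valP y).
  by rewrite big_map /emb big_enum; apply: eq_bigr => y _; rewrite (cP _ y).
Qed.

Lemma embedding :
  exists em : {linear wbim K sigma rho -> lideal_mod (piw K sigma * pibw K tau)},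
    (forall gamma, gamma \in intervalL sigma rho ->
       lideal_val (em (wbasis K sigma rho gamma)) = piw K gamma * pibw K tau)
    /\ bijective em.
Proof.
pose f (v : wbim K sigma rho) : lideal_mod (piw K sigma * pibw K tau) :=
  LIdeal (emb_ideal v).
have fL : linear f.
  move=> a u v; apply: val_inj; rewrite -[RHS]/(a * emb u + emb v) -emb_hact.
  exact: (linearD emb (hact a u) v).
pose F : {linear wbim K sigma rho -> lideal_mod (piw K sigma * pibw K tau)} :=
  HB.pack f (GRing.isLinear.Build _ _ _ _ f fL).
exists F; split=> [g|].
  by rewrite mem_intervalL => /andP[sg _]; apply: emb_bvec.
have /choice[k kP] : forall h : lideal_mod (piw K sigma * pibw K tau),
    exists v, f v = h.
  move=> h; have [v e] := emb_surj (lideal_valP h).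
  by exists v; apply: val_inj.
exists k => // v; apply: emb_inj; exact: (congr1 val (kP (f v))).
Qed.

End Embedding.

Local Open Scope classical_set_scope.

Theorem theorem3p5 (R : realType) (n : nat) (sigma rho : 'S_n) :
  let pi : 'S_n -> hecke0 R[i] n := @piw R[i] n in
  let pib : 'S_n -> hecke0 R[i] n := @pibw R[i] n in
  let J := intervalL sigma (w0 n \oP rho^-1)%g in
  [/\ set_basis (K := R[i]) [set h | h \in lideal (pi sigma * pib rho)]
        [set pi gamma * pib rho | gamma in [set gamma | gamma \in J]],
      forall (gamma : 'S_n) (i : 'I_n.-1), gamma \in J ->
        hpi R[i] i * (pi gamma * pib rho)
          = (if i \in DesL gamma then pi gamma * pib rho
             else pi (adj i \oP gamma) * pib rho)
        /\ (i \notin DesL gamma ->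
             (pi (adj i \oP gamma) * pib rho = 0
                <-> i \in DesL (gamma \oP rho)))
    & exists em : {linear wbim R[i] sigma rho ->
                     lideal_mod (pi sigma * pib (rho^-1 \oP w0 n)%g)},
        (forall gamma, gamma \in intervalL sigma rho ->
           lideal_val (em (wbasis R[i] sigma rho gamma))
             = pi gamma * pib (rho^-1 \oP w0 n)%g)
        /\ bijective em].
Proof.
move=> pi pib J; split.
- exact: lideal_basis.
- move=> g i; rewrite (mem_intervalL _ erefl) => /andP[sg ag].
  rewrite !DesLE; split; first by rewrite hpi_pipib /dem; case: ifP.
  move=> ng; have e : pi (adj i \oP g) * pib rho = hpi R[i] i * pipib R[i] g rho.
    by rewrite hpi_pipib /dem (negbTE ng).
  split=> [t0|d]; last by rewrite e hpi_pipib_des.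
  apply: contraT => nd; have a' : length_additive (adj i \oP g) rho.
    by rewrite additive_adj.
  have := pipib_neq0 R[i] a'; by rewrite /pipib t0 eqxx.
- apply: embedding; by rewrite !pcompM invMg invgK mulgKV.
Qed.
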